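(* Let $f:K\to K'$, $g:K\to L$, $g':K'\to L$ be morphisms of augmented directed complexes, with $L$ decent, and let $h$ be an antihomotopy from $g$ to $g'f$. For $i\ge0$ and $u'=(u'_j)_{j\ge-1}$ in $(g'\backslash L)_i$, define $(f,h)^*_i(u')=((f,h)^*_i(u')_j)_{j\ge-1}$ by $$(f,h)^*_i(u')_j=\begin{cases}u'_jf_j+e(u'_{-1}(1))\,h_j&\text{if }i=0,\\ u'_jf_j&\text{if }i\ge1,\end{cases}$$ with $f_{-1}=\mathrm{id}_{\mathbb{Z}}$ and $h_{-1}=0$. Then the $(f,h)^*_i$, $i\ge0$, define a morphism of augmented directed complexes $(f,h)^*:g'\backslash L\to g\backslash L$.
   Context: An augmented directed complex is a triple $(K,K^*,e)$ with $K$ a chain complex of abelian groups in degrees $\ge 0$, $e:K_0\to\mathbb{Z}$ a morphism with $ed_1=0$, and $K^*_n\subset K_n$ a submonoid for each $n\ge0$ (no compatibility with $d$ required). Morphisms are chain maps compatible with the augmentations and sending $K^*_n$ into $K'^*_n$. It is decent if $e(x)\ge0$ for all $x\in K^*_0$. An antihomotopy $h$ from $p$ to $q$, for morphisms $p,q:K\to L$, is a family of group morphisms $h_i:K_i\to L_{i+1}$, $i\ge0$, with $d_{i+1}h_i-h_{i-1}d_i=(-1)^i(q_i-p_i)$ (where $h_{-1}=0$ and $d_0=0$) and $h_i(K_i^* )\subset L^*_{i+1}$. For a morphism $g:K\to M$ of augmented directed complexes, the slice $g\backslash M$ is the augmented directed complex defined as follows. Convene $K_{-1}=M_{-1}=\mathbb{Z}$,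 $K^*_{-1}=M^*_{-1}=\mathbb{N}$, $d_0=e$, $g_{-1}=\mathrm{id}_{\mathbb{Z}}$, and everything is $0$ in degrees $\le-2$. Then $(g\backslash M)_i=\prod_{j\ge-1}\mathrm{Hom}(K_j,M_{i+j+1})$ for $i\ge1$; $(g\backslash M)_0\subset\prod_{j\ge-1}\mathrm{Hom}(K_j,M_{j+1})$ is the set of $(u_j)_{j\ge-1}$ with $(-1)^{j+1}(d_{j+1}u_j-u_{j-1}d_j)=e(u_{-1}(1))\,g_j$ for all $j\ge0$; the differential is $d_i(u)_j=(-1)^{j+1}(d_{i+j+1}u_j-u_{j-1}d_j)$ for $j\ge-1$ (with $u_{-2}=0$); the augmentation is $e(u)=e(u_{-1}(1))$; $(g\backslash M)^*_i$ consists of the $u\in(g\backslash M)_i$ with $u_j(K^*_j)\subset M^*_{i+j+1}$ for all $j\ge-1$. *)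

(* Defs.v *)
(* The classical axioms are used to give groups of homomorphisms, and products
   of them, a zmodType structure. *)
From HB Require Import structures.
From mathcomp Require Import all_boot all_order all_algebra.
From mathcomp Require Import boolp classical_sets.

Set Implicit Arguments.
Unset Strict Implicit.
Unset Printing Implicit Defensive.

Import GRing.Theory Num.Theory.
Local Open Scope ring_scope.

Section AdditiveZmod.
Variables U V : zmodType.
Implicit Types f g h : {additive U -> V}.

Lemma additive_eqP f g : f =1 g -> f = g.
Proof.
case: f => f [[fP]]; case: g => g [[gP]] /= /funext fg.
by case: _ / fg in gP *; rewrite (Prop_irrelevance gP fP).
Qed.

HB.instance Definition _ := gen_eqMixin {additive U -> V}.
HB.instance Definition _ := gen_choiceMixin {additive U -> V}.

Let addf f g : {additive U -> V} := f \+ g.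
Let oppf f : {additive U -> V} := \- f.

Fact additive_addA : associative addf.
Proof. by move=> f g h; apply: additive_eqP => x /=; rewrite addrA. Qed.
Fact additive_addC : commutative addf.
Proof. by move=> f g; apply: additive_eqP => x /=; rewrite addrC. Qed.
Fact additive_add0 : left_id (\0 : {additive U -> V}) addf.
Proof. by move=> f; apply: additive_eqP => x /=; rewrite add0r. Qed.
Fact additive_addN : left_inverse (\0 : {additive U -> V}) oppf addf.
Proof. by move=> f; apply: additive_eqP => x /=; rewrite addNr. Qed.

HB.instance Definition _ := GRing.isZmodule.Build {additive U -> V}
  additive_addA additive_addC additive_add0 additive_addN.

End AdditiveZmod.

Record adc := ADC {
  adc_deg :> nat -> zmodType;
  adc_d : forall n, {additive adc_deg n.+1 -> adc_deg n};
  adc_aug : {additive adc_deg 0%N -> int};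
  adc_star : forall n, set (adc_deg n);
  adc_dd : forall n x, adc_d n (adc_d n.+1 x) = 0;
  adc_aug_d : forall x, adc_aug (adc_d 0 x) = 0;
  adc_star0 : forall n, adc_star (0 : adc_deg n);
  adc_starD : forall n (x y : adc_deg n),
    adc_star x -> adc_star y -> adc_star (x + y) }.

Arguments adc_star : clear implicits.
Arguments adc_d : clear implicits.
Arguments adc_aug : clear implicits.

Definition decent (K : adc) : Prop :=
  forall x, adc_star K 0 x -> 0 <= adc_aug K x.

Record adc_hom (K L : adc) := AdcHom {
  adc_map :> forall n, {additive K n -> L n};
  adc_map_d : forall n x, adc_d L n (adc_map n.+1 x) = adc_map n (adc_d K n x);
  adc_map_aug : forall x, adc_aug L (adc_map 0 x) = adc_aug K x;
  adc_map_star : forall n x, adc_star K n x -> adc_star L n (adc_map n x) }.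

Section Comp.
Variables (K L M : adc) (g : adc_hom L M) (f : adc_hom K L).

Let comp_map n : {additive K n -> M n} := g n \o f n.

Fact adc_comp_d n x : adc_d M n (comp_map n.+1 x) = comp_map n (adc_d K n x).
Proof. by rewrite /= !adc_map_d. Qed.
Fact adc_comp_aug x : adc_aug M (comp_map 0 x) = adc_aug K x.
Proof. by rewrite /= !adc_map_aug. Qed.
Fact adc_comp_star n x : adc_star K n x -> adc_star M n (comp_map n x).
Proof. by move=> xs; do 2 apply: adc_map_star. Qed.

Definition adc_comp : adc_hom K M :=
  AdcHom adc_comp_d adc_comp_aug adc_comp_star.
End Comp.

(* The term h_{n-1} d_n, which is 0 for n = 0. *)
Definition antihomotopy_hd (K L : adc)
    (h : forall n, {additive K n -> L n.+1}) (n : nat) : K n -> L n :=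
  match n with
  | 0 => fun _ => 0
  | m.+1 => fun x => h m (adc_d K m x)
  end.

Record antihomotopy (K L : adc) (p q : adc_hom K L) := Antihomotopy {
  ah_map :> forall n, {additive K n -> L n.+1};
  ah_d : forall n x, adc_d L n (ah_map n x) - antihomotopy_hd ah_map x =
                     (q n x - p n x) *~ (-1) ^+ n;
  ah_star : forall n x, adc_star K n x -> adc_star L n.+1 (ah_map n x) }.

(* Complexes are extended to degree -1 with degrees shifted by one: index [k]
   stands for degree [k - 1], so that index [0] carries the integers and
   [ext_d K 0] is the augmentation. *)
Definition ext_deg (K : adc) (k : nat) : zmodType :=
  if k is j.+1 then K j else int.

Definition ext_d (K : adc) (k : nat) :
    {additive ext_deg K k.+1 -> ext_deg K k} :=
  if k is j.+1 then adc_d K j else adc_aug K.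

Definition ext_star (K : adc) (k : nat) : set (ext_deg K k) :=
  if k is j.+1 then adc_star K j else [set z : int | 0 <= z].

Arguments ext_star : clear implicits.

Definition ext_map (K L : adc) (f : adc_hom K L) (k : nat) :
    {additive ext_deg K k -> ext_deg L k} :=
  match k with
  | 0 => idfun
  | j.+1 => f j
  end.

Definition ext_ah (K L : adc) (p q : adc_hom K L) (h : antihomotopy p q)
    (k : nat) : {additive ext_deg K k -> L k} :=
  match k with
  | 0 => \0
  | j.+1 => h j
  end.

Lemma ext_dd (K : adc) k x : ext_d K k (ext_d K k.+1 x) = 0.
Proof. case: k x => [|k] x; [exact: adc_aug_d | exact: adc_dd]. Qed.

(* The product over j >= -1 of the groups Hom(K_j, M_{i+j+1}), indexed by
   [k = j + 1]. *)
Definition slice_prod (K M : adc) (i : nat) : Type :=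
  forall k : nat, {additive ext_deg K k -> M (i + k)%N}.

Identity Coercion slice_prod_fun : slice_prod >-> Funclass.

Section SliceProd.
Variables (K M : adc) (i : nat).
Implicit Types u v w : slice_prod K M i.

HB.instance Definition _ := gen_eqMixin (slice_prod K M i).
HB.instance Definition _ := gen_choiceMixin (slice_prod K M i).

Let addu u v : slice_prod K M i := fun k => u k + v k.
Let oppu u : slice_prod K M i := fun k => - u k.
Let zerou : slice_prod K M i := fun k => 0.

Fact slice_prod_addA : associative addu.
Proof. by move=> u v w; apply: functional_extensionality_dep => k; exact: addrA. Qed.
Fact slice_prod_addC : commutative addu.
Proof. by move=> u v; apply: functional_extensionality_dep => k; exact: addrC. Qed.
Fact slice_prod_add0 : left_id zerou addu.
Proof. by move=> u; apply: functional_extensionality_dep => k; exact: add0r. Qed.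
Fact slice_prod_addN : left_inverse zerou oppu addu.
Proof. by move=> u; apply: functional_extensionality_dep => k; exact: addNr. Qed.

HB.instance Definition _ := GRing.isZmodule.Build (slice_prod K M i)
  slice_prod_addA slice_prod_addC slice_prod_add0 slice_prod_addN.

Lemma slice_prodDE u v k x : (u + v) k x = u k x + v k x.
Proof. by []. Qed.
Lemma slice_prodNE u k x : (- u) k x = - u k x.
Proof. by []. Qed.
Lemma slice_prodBE u v k x : (u - v) k x = u k x - v k x.
Proof. by []. Qed.
Lemma slice_prod0E k x : (0 : slice_prod K M i) k x = 0.
Proof. by []. Qed.
Lemma slice_prodP u v : (forall k x, u k x = v k x) -> u = v.
Proof.
by move=> uv; apply: functional_extensionality_dep => k; apply: additive_eqP.
Qed.

End SliceProd.

(* For [u] of degree [i + 1], the term u_{j-1} d_j of index [k = j + 1];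
   it is 0 for k = 0 since u_{-2} = 0.  The cast identifies M_{(i+1)+k} with
   M_{i+(k+1)}. *)
Definition slice_ud (K M : adc) (i : nat) (u : slice_prod K M i.+1) (k : nat) :
    ext_deg K k -> M (i + k)%N :=
  match k with
  | 0 => fun _ => 0
  | j.+1 => fun x => ecast n (M n) (addSnnS i j) (u j (ext_d K j x))
  end.

Section SliceDiff.
Variables (K M : adc) (i : nat).
Implicit Types u v : slice_prod K M i.+1.

Definition slice_prod_d_fun u (k : nat) (x : ext_deg K k) : M (i + k)%N :=
  (adc_d M (i + k) (u k x) - slice_ud u x) *~ (-1) ^+ k.

Lemma ecastB m n (e : m = n) (a b : M m) :
  ecast n (M n) e (a - b) = ecast n (M n) e a - ecast n (M n) e b.
Proof. by case: _ / e. Qed.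

Lemma slice_udB u k (x y : ext_deg K k) :
  slice_ud u (x - y) = slice_ud u x - slice_ud u y.
Proof. by case: k x y => [|k] x y /=; rewrite ?subr0 // !raddfB ecastB. Qed.

Lemma slice_ud_prodB u v k (x : ext_deg K k) :
  slice_ud (u - v) x = slice_ud u x - slice_ud v x.
Proof.
case: k x => [|k] x; first by rewrite /= subr0.
by rewrite /slice_ud slice_prodBE ecastB.
Qed.

Fact slice_prod_d_fun_subproof u k :
  zmod_morphism (@slice_prod_d_fun u k).
Proof.
move=> x y; rewrite /slice_prod_d_fun slice_udB !raddfB /= -mulrzBl.
by rewrite !opprD !addrA; congr (_ *~ _); rewrite -!addrA; congr (_ + _);
   rewrite addrCA.
Qed.

HB.instance Definition _ u k := GRing.isZmodMorphism.Build
  (ext_deg K k) (M (i + k)%N) (@slice_prod_d_fun u k)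
  (@slice_prod_d_fun_subproof u k).

Definition slice_prod_d u : slice_prod K M i :=
  fun k => @slice_prod_d_fun u k.

Lemma slice_prod_dE u k x : slice_prod_d u k x =
  (adc_d M (i + k) (u k x) - slice_ud u x) *~ (-1) ^+ k.
Proof. by []. Qed.

Lemma slice_prod_dB u v :
  slice_prod_d (u - v) = slice_prod_d u - slice_prod_d v.
Proof.
apply: slice_prodP => k x; rewrite slice_prodBE !slice_prod_dE slice_ud_prodB.
rewrite slice_prodBE !raddfB /= -mulrzBl; congr (_ *~ _).
by rewrite !opprD !addrA -!addrA; congr (_ + _); rewrite addrCA.
Qed.

End SliceDiff.

Lemma slice_ud_dd (K M : adc) i (u : slice_prod K M i.+1) k
  (x : ext_deg K k.+1) : slice_ud u (ext_d K k x) = 0.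
Proof.
case: k x => [//|k] x; rewrite /slice_ud ext_dd raddf0.
by case: _ / (addSnnS i k).
Qed.

Lemma slice_prod_dd (K M : adc) i (u : slice_prod K M i.+2) :
  slice_prod_d (slice_prod_d u) = 0.
Proof.
apply: slice_prodP => k x; rewrite slice_prod0E slice_prod_dE.
suff -> : adc_d M (i + k) (slice_prod_d u k x) = slice_ud (slice_prod_d u) x
  by rewrite subrr mul0rz.
have dcast m n (e : m = n) (e' : m.+1 = n.+1) (a : M m.+1) :
  adc_d M n (ecast n (M n) e' a) = ecast n (M n) e (adc_d M m a).
  by case: _ / e in e' *; rewrite (eq_irrelevance e' erefl).
case: k x => [|k] x.
  by rewrite slice_prod_dE /= subr0 adc_dd.
rewrite slice_prod_dE /= slice_prod_dE raddfMz raddfB /= adc_dd sub0r.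
rewrite (dcast _ _ (addSnnS i k)).
have ecastMz m n (e : m = n) (a : M m) z :
  ecast n (M n) e (a *~ z) = ecast n (M n) e a *~ z by case: _ / e.
rewrite ecastMz exprS mulN1r mulrNz mulNrz opprK; congr (_ *~ _).
rewrite ecastB.
by rewrite slice_ud_dd; case: _ / (addSnnS i k); rewrite subr0.
Qed.

Section Slice.
Variables (K M : adc) (g : adc_hom K M).

(* The equation in degree j >= 0 is that of index [k = j + 1]. *)
Definition slice_cond0 (u : slice_prod K M 0) : Prop :=
  forall (j : nat) (x : K j),
    (adc_d M j (u j.+1 x) - u j (ext_d K j x)) *~ (-1) ^+ j.+1
    = g j x *~ adc_aug M (u 0 1).

Definition slice_cond (i : nat) : slice_prod K M i -> Prop :=
  match i with
  | 0 => slice_cond0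
  | _ => fun _ => True
  end.

Definition slice_mem (i : nat) : {pred slice_prod K M i} :=
  fun u => `[< slice_cond u >].

Lemma slice_memP i (u : slice_prod K M i) :
  reflect (slice_cond u) (u \in @slice_mem i).
Proof. exact: asboolP. Qed.

Fact slice_mem_subproof i : zmod_closed (@slice_mem i).
Proof.
case: i => [|i]; split; try by move=> *; apply/slice_memP.
  apply/slice_memP => j x.
  by rewrite !slice_prod0E raddf0 subrr mul0rz raddf0 mulr0z.
move=> u v /slice_memP uP /slice_memP vP; apply/slice_memP => j x.
rewrite !slice_prodBE !raddfB /= -(uP j x) -(vP j x) -mulrzBl.
by congr (_ *~ _); rewrite opprB opprK addrACA [- _ + _]addrC.
Qed.

HB.instance Definition _ i := GRing.isZmodClosed.Build
  (slice_prod K M i) (@slice_mem i) (@slice_mem_subproof i).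

Record slice_deg (i : nat) := SliceDeg {
  slice_val :> slice_prod K M i;
  slice_valP : slice_val \in @slice_mem i }.

HB.instance Definition _ i := [isSub for @slice_val i].
HB.instance Definition _ i := [Choice of slice_deg i by <:].
HB.instance Definition _ i := [SubChoice_isSubZmodule of slice_deg i by <:].

Lemma slice_degBE i (u v : slice_deg i) k x :
  slice_val (u - v) k x = u k x - v k x.
Proof. by []. Qed.

Lemma slice_degP i (u v : slice_deg i) :
  (forall k x, u k x = v k x) -> u = v.
Proof. by move=> uv; apply: val_inj; apply: slice_prodP. Qed.

Fact slice_prod_d_mem i (u : slice_deg i.+1) :
  slice_prod_d u \in @slice_mem i.
Proof.
apply/slice_memP; case: i u => [|//] u j x.
have -> : adc_aug M (slice_prod_d u 0 1) = 0.
  by rewrite slice_prod_dE /= subr0 adc_aug_d.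
rewrite mulr0z; apply/eqP; rewrite (_ : _ - _ = 0) ?mul0rz //.
rewrite !slice_prod_dE slice_ud_dd subr0 raddfMz raddfB /= adc_dd sub0r.
rewrite (eq_irrelevance (addSnnS 0 j) erefl) /=.
by rewrite exprS mulN1r mulrNz mulNrz opprK subrr.
Qed.

Definition slice_d_fun i (u : slice_deg i.+1) : slice_deg i :=
  SliceDeg (slice_prod_d_mem u).

Fact slice_d_fun_subproof i : zmod_morphism (@slice_d_fun i).
Proof. by move=> u v; apply: val_inj; exact: slice_prod_dB. Qed.

HB.instance Definition _ i := GRing.isZmodMorphism.Build
  (slice_deg i.+1) (slice_deg i) (@slice_d_fun i) (@slice_d_fun_subproof i).

Definition slice_aug_fun (u : slice_deg 0) : int := adc_aug M (u 0 1).

Fact slice_aug_fun_subproof : zmod_morphism slice_aug_fun.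
Proof. by move=> u v; rewrite /slice_aug_fun slice_degBE raddfB. Qed.

HB.instance Definition _ := GRing.isZmodMorphism.Build
  (slice_deg 0) int slice_aug_fun slice_aug_fun_subproof.

Definition slice_star (i : nat) : set (slice_deg i) :=
  [set u : slice_deg i | forall k x, ext_star K k x -> adc_star M (i + k) (u k x)].

Fact slice_dd i (u : slice_deg i.+2) : slice_d_fun (slice_d_fun u) = 0.
Proof. by apply: val_inj; exact: slice_prod_dd. Qed.

Fact slice_aug_d (u : slice_deg 1) : slice_aug_fun (slice_d_fun u) = 0.
Proof.
by rewrite /slice_aug_fun /= slice_prod_dE /= subr0 adc_aug_d.
Qed.

Fact slice_star0 i : slice_star (0 : slice_deg i).
Proof. by move=> k x _; exact: adc_star0. Qed.

Fact slice_starD i (u v : slice_deg i) :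
  slice_star u -> slice_star v -> slice_star (u + v).
Proof. by move=> us vs k x xs; apply: adc_starD; [exact: us | exact: vs]. Qed.

Definition slice : adc := @ADC slice_deg slice_d_fun slice_aug_fun slice_star
  slice_dd slice_aug_d slice_star0 slice_starD.

End Slice.

(* Main.v *)
Require Import Defs.
From HB Require Import structures.
From mathcomp Require Import all_boot all_order all_algebra.
From mathcomp Require Import boolp classical_sets.

Set Implicit Arguments.
Unset Strict Implicit.
Unset Printing Implicit Defensive.

Import GRing.Theory Num.Theory.
Local Open Scope ring_scope.

(** The map (f,h)^* is precomposition with f, corrected in degree 0 by e(u') h.
    Precomposition with a chain map commutes with the differential of the
    products of groups of homomorphisms ([slice_ud_precomp]), and it preserves
    positivity.  But in degree 0 it takes the cocycle-like condition of the
    slice of g', of right-hand side e(u') g', to the one with right-hand side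
    e(u') g'f instead of e(u') g.  The difference is a multiple of g'f - g,
    which is what h bounds: the sign (-1)^j of an antihomotopy is opposite to
    the sign (-1)^(j+1) of the condition, so that adding e(u') h turns g'f
    into g ([slice_pull0_cond]).

    The correction does not affect the other requirements.  It is zero on
    boundaries because the augmentation kills them, hence compatibility with
    the differential; it is zero in degree -1, hence compatibility with the
    augmentation; and if u' is positive then u'_(-1)(1) lies in L^*_0, so that
    e(u') >= 0 because L is decent, and e(u') h is positive. *)

Lemma adc_star_mulz (M : adc) n (x : M n) (z : int) :
  0 <= z -> adc_star M n x -> adc_star M n (x *~ z).
Proof.
case: z => // m _ xs; rewrite -pmulrn.
by elim: m => [|m IHm]; [exact: adc_star0 | rewrite mulrS; exact: adc_starD].
Qed.

Section ExtMap.
Variables (K L : adc) (f : adc_hom K L).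

Lemma ext_map_d k (x : ext_deg K k.+1) :
  ext_d L k (ext_map f k.+1 x) = ext_map f k (ext_d K k x).
Proof. by case: k x => [|k] x; [exact: adc_map_aug | exact: adc_map_d]. Qed.

Lemma ext_map_star k (x : ext_deg K k) :
  ext_star K k x -> ext_star L k (ext_map f k x).
Proof. by case: k x => [//|k] x; exact: adc_map_star. Qed.

End ExtMap.

Section ExtAntihomotopy.
Variables (K L : adc) (p q : adc_hom K L) (h : antihomotopy p q).

(** Setting h_(-1) = 0 makes the equation uniform in all degrees, including
    degree 0. *)
Lemma ext_ah_d j (x : K j) :
  adc_d L j (ext_ah h j.+1 x) - ext_ah h j (ext_d K j x)
  = (q j x - p j x) *~ (-1) ^+ j.
Proof. by rewrite -(ah_d h); case: j x. Qed.

Lemma ext_ah_star k (x : ext_deg K k) :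
  ext_star K k x -> adc_star L k (ext_ah h k x).
Proof.
by case: k x => [|k] x; [move=> _; exact: adc_star0 | exact: ah_star].
Qed.

End ExtAntihomotopy.

Section Precomp.
Variables (K K' M : adc) (f : adc_hom K K').

Definition slice_precomp i (u : slice_prod K' M i) : slice_prod K M i :=
  fun k => u k \o ext_map f k.

Lemma slice_ud_precomp i (u : slice_prod K' M i.+1) k (x : ext_deg K k) :
  slice_ud (slice_precomp u) x = slice_ud u (ext_map f k x).
Proof. by case: k x => [//|k] x; rewrite /slice_ud ext_map_d. Qed.

Lemma slice_prod_d_precomp i (u : slice_prod K' M i.+1) :
  slice_prod_d (slice_precomp u) = slice_precomp (slice_prod_d u).
Proof.
by apply: slice_prodP => k x; rewrite slice_prod_dE slice_ud_precomp.
Qed.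

End Precomp.

Section Pull.
Variables (K K' L : adc) (f : adc_hom K K').
Variables (g : adc_hom K L) (g' : adc_hom K' L).
Variable h : antihomotopy g (adc_comp g' f).

Definition ext_ah_mulz_fun (z : int) k (x : ext_deg K k) : L (0 + k)%N :=
  ext_ah h k x *~ z.

Fact ext_ah_mulz_fun_subproof z k : zmod_morphism (@ext_ah_mulz_fun z k).
Proof. by move=> x y; rewrite /ext_ah_mulz_fun raddfB mulrzBl. Qed.

HB.instance Definition _ z k := GRing.isZmodMorphism.Build
  (ext_deg K k) (L (0 + k)%N) (@ext_ah_mulz_fun z k)
  (@ext_ah_mulz_fun_subproof z k).

Definition ext_ah_mulz z : slice_prod K L 0 := fun k => @ext_ah_mulz_fun z k.

Definition slice_pull_prod i : slice_deg g' i -> slice_prod K L i :=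
  match i with
  | 0 => fun u => slice_precomp f u + ext_ah_mulz (adc_aug L (u 0%N 1))
  | _.+1 => fun u => slice_precomp f u
  end.

Lemma slice_pull0E (u : slice_deg g' 0) k x :
  slice_pull_prod u k x
  = u k (ext_map f k x) + ext_ah h k x *~ adc_aug L (u 0%N 1).
Proof. by []. Qed.

Lemma adc_aug_slice_pull0 (u : slice_deg g' 0) :
  adc_aug L (slice_pull_prod u 0%N 1) = adc_aug L (u 0%N 1).
Proof. by rewrite slice_pull0E /= mul0rz addr0. Qed.

(** With e = e(u'), precomposition contributes e g'f to the condition and e h
    contributes - e (g'f - g), because the two signs are opposite; the sum is
    e g. *)
Lemma slice_pull0_cond (u : slice_deg g' 0) : slice_cond0 g (slice_pull_prod u).
Proof.
move=> j x; rewrite adc_aug_slice_pull0 !slice_pull0E -ext_map_d.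
have /slice_memP/(_ j (f j x)) := slice_valP u.
set e := adc_aug L _ => uP.
rewrite raddfD raddfMz opprD addrACA mulrzDl uP -mulrzBl ext_ah_d.
rewrite mulrzAC exprS mulN1r mulrNz -mulrzA -expr2 sqrr_sign mulr1z.
by rewrite mulNrz -mulrzBl opprB addrC subrK.
Qed.

Fact slice_pull_mem i (u : slice_deg g' i) :
  slice_pull_prod u \in @slice_mem K L g i.
Proof. by apply/slice_memP; case: i u => [|//] u; exact: slice_pull0_cond. Qed.

Definition slice_pull_fun i (u : slice_deg g' i) : slice_deg g i :=
  SliceDeg (slice_pull_mem u).

Fact slice_pull_fun_subproof i : zmod_morphism (@slice_pull_fun i).
Proof.
case: i => [|i] u v; apply: slice_degP => k x //.
by rewrite slice_degBE /= /ext_ah_mulz_fun raddfB mulrzBr opprD addrACA.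
Qed.

HB.instance Definition _ i := GRing.isZmodMorphism.Build
  (slice_deg g' i) (slice_deg g i) (@slice_pull_fun i)
  (@slice_pull_fun_subproof i).

(** Only the differential from degree 1 meets the correction, which vanishes
    there because the augmentation of a boundary is zero. *)
Fact slice_pull_d i (u : slice_deg g' i.+1) :
  slice_d_fun (slice_pull_fun u) = slice_pull_fun (slice_d_fun u).
Proof.
apply: val_inj; rewrite /= slice_prod_d_precomp; case: i u => [|//] u.
apply: slice_prodP => k x; rewrite slice_pull0E.
have -> : adc_aug L (slice_d_fun u 0%N 1) = 0 by exact: slice_aug_d.
by rewrite mulr0z addr0.
Qed.

Fact slice_pull_aug (u : slice_deg g' 0) :
  slice_aug_fun (slice_pull_fun u) = slice_aug_fun u.
Proof. exact: adc_aug_slice_pull0. Qed.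

Fact slice_pull_star (L_decent : decent L) i (u : slice_deg g' i) :
  slice_star u -> slice_star (slice_pull_fun u).
Proof.
move=> us k x xs; have fs := us _ _ (ext_map_star f xs).
case: i u us fs => [|//] u us fs.
apply: adc_starD => //; apply: adc_star_mulz; last exact: ext_ah_star.
by apply: L_decent; exact: us.
Qed.

Definition slice_pull (L_decent : decent L) : adc_hom (slice g') (slice g) :=
  @AdcHom (slice g') (slice g) slice_pull_fun slice_pull_d slice_pull_aug
    (slice_pull_star L_decent).

End Pull.

Theorem proposition10p2p2 (K K' L : adc)
    (f : adc_hom K K') (g : adc_hom K L) (g' : adc_hom K' L)
    (L_decent : decent L) (h : antihomotopy g (adc_comp g' f)) :
  exists F : adc_hom (slice g') (slice g),
    (forall (u : slice_deg g' 0) (k : nat) (x : ext_deg K k),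
       slice_val (F 0%N u) k x
       = u k (ext_map f k x) + ext_ah h k x *~ adc_aug L (u 0%N 1))
    /\ (forall (i : nat) (u : slice_deg g' i.+1) (k : nat) (x : ext_deg K k),
          slice_val (F i.+1 u) k x = u k (ext_map f k x)).
Proof. by exists (slice_pull h L_decent). Qed.
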